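(* $\text{\ss}_o \leq \max\{\text{\ss},\mathfrak{b}\}$.
   Context: $\mathbb{N}=\{1,2,3,\dots\}$. For $A\subseteq\mathbb{N}$, the subseries $\sum_{n\in A}a_n$ is summed in increasing order of the indices; if $A$ is finite it counts as convergent. A series is conditionally convergent if it converges but not absolutely. A series diverges by oscillation if its partial sums neither converge to a real number nor tend to $+\infty$ nor tend to $-\infty$. The subseries number $\text{\ss}$ is the smallest cardinality of a family $\mathcal{A}$ of subsets of $\mathbb{N}$ such that for every conditionally convergent series $\sum_{n\in\mathbb{N}}a_n$ of real numbers there is $A\in\mathcal{A}$ such that $\sum_{n\in A}a_n$ diverges. $\text{\ss}_o$ is defined in the same way, except that $\sum_{n\in A}a_n$ is required to diverge by oscillation. For $f,g:\mathbb{N}\to\mathbb{N}$, $f\leq^* g$ means $f(n)\leq g(n)$ for all but finitely many $n$. The bounding number $\mathfrak{b}$ is the minimum cardinality of a family $\mathcal{B}$ of functions $\mathbb{N}\to\mathbb{N}$ such that no single $g:\mathbb{N}\to\mathbb{N}$ satisfies $f\leq^* g$ for all $f\in\mathcal{B}$. *)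

(* Defs.v *)
From mathcomp Require Import all_boot all_order all_algebra.
From mathcomp Require Import all_classical all_reals all_analysis.
Set Implicit Arguments.
Unset Strict Implicit.
Unset Printing Implicit Defensive.
Import Order.TTheory GRing.Theory Num.Theory.
Import numFieldNormedType.Exports.
Local Open Scope classical_set_scope.
Local Open Scope ring_scope.
Local Open Scope card_scope.

(* Cardinal numbers are represented by sets of that cardinality and compared  *)
(* by [#<=]. "The smallest cardinality of a set satisfying P" is represented  *)
(* by a chosen set that satisfies P and injects into every other set          *)
(* satisfying P; [least_setP] shows that such a set exists as soon as P is    *)
(* satisfiable, so the default value of [get] plays no role.                  *)
Definition least_set (T : Type) (P : set (set T)) : set T :=
  get [set A | P A /\ forall B, P B -> A #<= B].

Lemma least_setP (T : Type) (P : set (set T)) : P !=set0 ->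
  P (least_set P) /\ forall B, P B -> least_set P #<= B.
Proof.
move=> [A0 PA0]; apply: (@getPex _ [set A | P A /\ forall B, P B -> A #<= B]).
pose Q (F : set (set T -> T)) :=
  (forall c A, F c -> P A -> A (c A)) /\
  (forall c d A, F c -> F d -> P A -> c A = d A -> c = d).
have [F [[Fin Finj] Fmax]] : exists F, Q F /\ forall G, F `<` G -> ~ Q G.
  apply: Zorn_bigcup => FF FFQ FFtot; split.
    by move=> c A [X FX Xc] PA; case: (FFQ _ FX) => h _; exact: (h c A Xc PA).
  move=> c d A [X FX Xc] [Y FY Yd] PA; case: (FFtot _ _ FX FY) => XY.
    by case: (FFQ _ FY) => _ h; apply: h (XY _ Xc) Yd PA.
  by case: (FFQ _ FX) => _ h; apply: h Xc (XY _ Yd) PA.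
have [A PA AF] : exists2 A, P A & A `<=` [set c A | c in F].
  apply: contrapT => nA.
  have ex A : P A -> exists2 x, A x & ~ [set c A | c in F] x.
    move=> PA; apply: contrapT => h; apply: nA; exists A => // x Ax.
    by apply: contrapT => nx; apply: h; exists x.
  have [x0 _ _] := ex _ PA0.
  have /choice[c0 c0P] A : exists x, P A -> A x /\ ~ [set c A | c in F] x.
    have [PA|nPA] := pselect (P A); last by exists x0.
    by have [x Ax nx] := ex _ PA; exists x.
  apply: (Fmax (F `|` [set c0])).
    split; first by move=> c Fc; left.
    move=> sub; have Fc0 : F c0 by apply: sub; right.
    by have [_] := c0P _ PA0; apply; exists c0.
  split=> [c A [Fc|->] PA|c d A [Fc|->] [Fd|->] PA cd //].
  - exact: (Fin c _ Fc).
  - by have [] := c0P _ PA.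
  - exact: (Finj c d A).
  - by have [_] := c0P _ PA; case; exists c.
  - by have [_] := c0P _ PA; case; exists d.
exists A; split=> // B PB.
apply: (card_le_trans (subset_card_le AF)).
apply: (card_le_trans (card_image_le _ _)).
have /card_eqPle[_ FB] : [set c B | c in F] #= F.
  apply: inj_card_eq => c d /set_mem Fc /set_mem Fd; exact: (Finj c d B).
apply: (card_le_trans FB); apply: subset_card_le.
by move=> _ [c Fc <-]; exact: (Fin c _ Fc).
Qed.

(* Maximum of two cardinals; the two representing sets may live in different  *)
(* types, hence the sum type.                                                 *)
Definition card_max (T U : Type) (A : set T) (B : set U) : set (T + U) :=
  if A #<= B then inr @` B else inl @` A.

Section Subseries.
Variable R : realType.
Implicit Types (a : R^nat) (A : set nat).

Definition conditionally_convergent a : Prop :=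
  cvgn (series a) /\ ~ cvgn [normed series a].

(* The n-th term adds up, in increasing order, the a k with k in A and k < n. *)
(* These are the partial sums of the series over A in their natural order,    *)
(* possibly repeated; the sequence is eventually constant when A is finite.   *)
Definition subseries a A : R^nat :=
  fun n => \sum_(0 <= k < n | k \in A) a k.

Definition diverges (u : R^nat) : Prop := ~ cvgn u.

Definition oscillates (u : R^nat) : Prop :=
  [/\ ~ cvgn u, ~ (u @ \oo --> +oo) & ~ (u @ \oo --> -oo)].

Definition ss_family (F : set (set nat)) : Prop :=
  forall a, conditionally_convergent a ->
    exists2 A, F A & diverges (subseries a A).

Definition sso_family (F : set (set nat)) : Prop :=
  forall a, conditionally_convergent a ->
    exists2 A, F A & oscillates (subseries a A).

Definition subseries_number : set (set nat) := least_set ss_family.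

Definition osc_subseries_number : set (set nat) := least_set sso_family.

End Subseries.

Definition le_star (f g : nat -> nat) : Prop :=
  \forall n \near \oo, (f n <= g n)%N.

Definition unbounded_family (F : set (nat -> nat)) : Prop :=
  ~ exists g : nat -> nat, forall f, F f -> le_star f g.

Definition bounding_number : set (nat -> nat) := least_set unbounded_family.

(* Main.v *)
(* Let F witness the subseries number and B the bounding number, and suppose  *)
(* that the subseries of a conditionally convergent series a over A in F      *)
(* tends to an infinity; then the one over the complement of A tends to the   *)
(* opposite infinity. Since B is unbounded, some f in B cuts N into blocks    *)
(* infinitely many of which are long, in the sense that both subseries move   *)
(* along such a block by more than the absolute partial sum of a up to its    *)
(* beginning. The family F is splitting (apply its defining property to a     *)
(* series supported on the set to split), so some S in F contains infinitely  *)
(* many of the indices of long blocks and misses infinitely many of them. The *)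
(* set that agrees with A on the blocks in S and with the complement of A on  *)
(* the others yields an oscillating subseries. The number of such sets is at  *)
(* most |F| |F| |B|, which is max(|F|, |B|) as B is infinite.                 *)

Require Import Defs.
From mathcomp Require Import all_boot all_order all_algebra.
From mathcomp Require Import all_classical all_reals all_analysis.
From mathcomp Require Import lra.
Set Implicit Arguments.
Unset Strict Implicit.
Unset Printing Implicit Defensive.
Import Order.TTheory GRing.Theory Num.Theory.
Import numFieldNormedType.Exports.
Local Open Scope classical_set_scope.
Local Open Scope ring_scope.
Local Open Scope card_scope.

(** A divergent subseries that does not oscillate tends to an infinity, and the complementary
    subseries tends to the opposite one, because the two add up to bounded partial sums. Alternating
    between the set and its complement in blocks oscillates if infinitely many blocks of either kind
    outweigh all that was summed before them. How far such a block must reach is a modulus [g] from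
    [blocks_modulus]; [unbounded_family_long_blocks] finds one [f] in [B] whose blocks reach that
    far infinitely often. Which of these blocks follow the set is decided by a second member of [F],
    through [ss_family_splits], and [oscillates_blocks] concludes. [sso_family_alternations]
    collects the sets so obtained; [card_alternations] counts them, resting on [card_square] and,
    for the maximum, on [card_le_total]. *)

(** * Cardinal arithmetic from Zorn's lemma *)

Lemma card_le_injP (T U : Type) (u0 : U) (A : set T) (B : set U) :
  A #<= B <-> exists2 f : T -> U, (forall x, A x -> B (f x)) &
    (forall x y, A x -> A y -> f x = f y -> x = y).
Proof.
elim/Ppointed: U => U in u0 B *; first by case: (no u0).
split=> [/pcard_leP/injfunPex[f fAB fI]|[f fAB fI]].
  by exists f => // x y Ax Ay; apply: fI; rewrite inE.
apply/pcard_leP/injfunPex; exists f => //.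
by move=> x y /set_mem Ax /set_mem Ay; exact: fI.
Qed.

Lemma card_le_graph (T U : Type) (A : set T) (B : set U) (H : T -> U -> Prop) :
    (forall x, A x -> exists2 y, B y & H x y) ->
    (forall x x' y, A x -> A x' -> H x y -> H x' y -> x = x') ->
  A #<= B.
Proof.
move=> Hex Hinj; have [->//|/set0P[x0 Ax0]] := eqVneq A set0.
have [u0 _ _] := Hex _ Ax0.
have /choice[f fP] x : exists y, A x -> B y /\ H x y.
  have [/Hex[y By Hxy]|nAx] := pselect (A x); first by exists y.
  by exists u0.
apply/(card_le_injP u0); exists f => [x Ax|x y Ax Ay fxy].
  by case: (fP x Ax).
by apply: (Hinj x y (f x)) => //; [case: (fP x)|rewrite fxy; case: (fP y)].
Qed.

Lemma card_leX (T T' U U' : Type) (A : set T) (B : set U)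
    (A' : set T') (B' : set U') :
  A #<= A' -> B #<= B' -> A `*` B #<= A' `*` B'.
Proof.
have [->|/set0P[a Aa]] := eqVneq A set0; first by rewrite set0X.
have [->|/set0P[b Bb]] := eqVneq B set0; first by rewrite setX0.
have [->|/set0P[a' _]] := eqVneq A' set0.
  by rewrite card_le0 => /eqP A0; move: Aa; rewrite A0.
have [->|/set0P[b' _]] := eqVneq B' set0.
  by move=> _; rewrite card_le0 => /eqP B0; move: Bb; rewrite B0.
move=> /(card_le_injP a')[f fA fI] /(card_le_injP b')[g gB gI].
apply/(card_le_injP (a', b')); exists (fun x => (f x.1, g x.2)).
  by move=> [x y] [/= /fA ? /gB ?].
move=> [x y] [x2 y2] [/= Ax By] [/= Ax2 By2] [fx gy].
by rewrite (fI x x2)// (gI y y2).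
Qed.

(** Take a maximal graph of a partial injection from [A] to [B]. If it left out a point on each
    side, the pair of these points could be added; so it covers [A] or covers [B]. *)
Lemma card_le_total (T U : Type) (A : set T) (B : set U) :
  A #<= B \/ B #<= A.
Proof.
pose P (H : set (T * U)) := [/\ H `<=` A `*` B,
  forall x y y', H (x, y) -> H (x, y') -> y = y' &
  forall x x' y, H (x, y) -> H (x', y) -> x = x'].
have [H [[HAB Hf Hi] Hmax]] : exists H, P H /\ forall G, H `<` G -> ~ P G.
  apply: Zorn_bigcup => F FP Ftot.
  have chain p q : (\bigcup_(X in F) X) p -> (\bigcup_(X in F) X) q ->
      exists X, [/\ F X, X p & X q].
    move=> [X FX Xp] [Y FY Yq]; have [XY|YX] := Ftot _ _ FX FY.
      by exists Y; split=> //; exact: XY.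
    by exists X; split=> //; exact: YX.
  split.
  - by move=> p [X FX Xp]; have [h _ _] := FP _ FX; exact: h.
  - move=> x y y' /chain/[apply] -[X [FX Xp Xq]].
    by have [_ h _] := FP _ FX; exact: h Xp Xq.
  - move=> x x' y /chain/[apply] -[X [FX Xp Xq]].
    by have [_ _ h] := FP _ FX; exact: h Xp Xq.
have [HA|/existsNP[x /not_implyP[Ax nHx]]] :=
    pselect (forall x, A x -> exists y, H (x, y)).
  left; apply: (@card_le_graph _ _ _ _ (fun x y => H (x, y))).
    by move=> x /HA[y Hxy]; exists y => //; case: (HAB _ Hxy).
  by move=> x x' y _ _; exact: Hi.
have [HB|/existsNP[y /not_implyP[By nHy]]] :=
    pselect (forall y, B y -> exists x, H (x, y)).
  right; apply: (@card_le_graph _ _ _ _ (fun y x => H (x, y))).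
    by move=> y /HB[x' Hxy]; exists x' => //; case: (HAB _ Hxy).
  by move=> y y' z _ _; exact: Hf.
exfalso; apply: (Hmax (H `|` [set (x, y)])).
  split; first by move=> p; left.
  by move=> sub; apply: nHx; exists y; apply: sub; right.
split.
- by move=> p [/HAB//|->]; split.
- move=> x1 y1 y2 [H1|[-> ->]] [H2|[]]; first exact: Hf H1 H2.
  + by move=> xE _; case: nHx; exists y1; rewrite -xE.
  + by case: nHx; exists y2.
  + by move=> ->.
- move=> x1 x2 y1 [H1|[-> ->]] [H2|[]]; first exact: Hi H1 H2.
  + by move=> _ yE; case: nHy; exists x1; rewrite -yE.
  + by case: nHy; exists x2.
  + by move=> ->.
Qed.

(** The points [d] and [e] serve as tags: points of [A] go to pairs starting with [d], the remaining
    ones to pairs starting with [e]. *)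
Lemma card_leU (T U V : Type) (A B : set T) (D : set U) (M : set V) (d e : U) :
    D d -> D e -> d <> e -> D `*` D #<= M -> A #<= D -> B #<= D ->
  A `|` B #<= M.
Proof.
move=> Dd De de DM /(card_le_injP d)[f fA fI] /(card_le_injP d)[g gB gI].
apply: card_le_trans DM.
pose h x := if pselect (A x) then (d, f x) else (e, g x).
apply/(card_le_injP (d, d)); exists h => [x|x y]; rewrite /h.
  by case: pselect => [Ax _|nA [//|Bx]]; split => //=; [exact: fA|exact: gB].
case: pselect => Ax; case: pselect => Ay ABx ABy.
- by move=> [] /fI ->.
- by case=> /de.
- by case=> /esym/de.
- by case: ABx ABy => // Bx [//|By] [] /gI ->.
Qed.

Section Square.
Variables (T : Type) (X : set T).

Let field (H : set ((T * T) * T)) : set T :=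
  [set x | exists z, H ((x, x), z)].

(* H is the graph of an injection of D `*` D into D for an empty or infinite  *)
(* subset D = field H of X.                                                   *)
Let square_graph (H : set ((T * T) * T)) : Prop :=
  [/\ field H `<=` X /\ (field H !=set0 -> infinite_set (field H)),
      forall x y z, H ((x, y), z) -> [/\ field H x, field H y & field H z],
      forall x y, field H x -> field H y -> exists z, H ((x, y), z),
      forall p z z', H (p, z) -> H (p, z') -> z = z' &
      forall p p' z, H (p, z) -> H (p', z) -> p = p'].

Let square_graph_chain (F : set (set ((T * T) * T))) :
  F `<=` square_graph -> total_on F subset ->
  square_graph (\bigcup_(H in F) H).
Proof.
move=> FP Ftot.
have chain p q : (\bigcup_(H in F) H) p -> (\bigcup_(H in F) H) q ->
    exists H, [/\ F H, H p & H q].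
  move=> [X0 FX Xp] [Y FY Yq]; have [XY|YX] := Ftot _ _ FX FY.
    by exists Y; split=> //; exact: XY.
  by exists X0; split=> //; exact: YX.
have fieldS H : F H -> field H `<=` field (\bigcup_(H in F) H).
  by move=> FH x [z Hz]; exists z, H.
have fieldE x : field (\bigcup_(H in F) H) x -> exists2 H, F H & field H x.
  by move=> [z [H FH Hz]]; exists H => //; exists z.
split.
- split=> [x /fieldE[H FH]|[x /fieldE[H FH Hx]]].
    by have [[+ _] _ _ _ _] := FP _ FH; apply.
  apply: (sub_infinite_set (fieldS _ FH)).
  by have [[_ h] _ _ _ _] := FP _ FH; apply: h; exists x.
- move=> x y z [H FH Hp]; have [_ h _ _ _] := FP _ FH.
  by have [? ? ?] := h _ _ _ Hp; split; exact: fieldS FH _ _.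
- move=> x y [z Hz] [w Hw]; have [H [FH Hx Hy]] := chain _ _ Hz Hw.
  have [_ _ h _ _] := FP _ FH.
  by have [||v Hv] := h x y; [exists z|exists w|exists v, H].
- move=> p z z' /chain/[apply] -[H [FH Hx Hy]].
  by have [_ _ _ h _] := FP _ FH; exact: h Hx Hy.
- move=> p z z' /chain/[apply] -[H [FH Hx Hy]].
  by have [_ _ _ _ h] := FP _ FH; exact: h Hx Hy.
Qed.

(** The pairs over the enlarged field that are not already pairs over [field H] are sent injectively
    into [D']. As [D'] is disjoint from [field H], the new values never collide with the old
    ones. *)
Let square_graph_extend (H : set ((T * T) * T)) (D' : set T) :
    square_graph H -> D' `<=` X -> D' `&` field H `<=` set0 ->
    infinite_set D' ->
    (field H `|` D') `*` (field H `|` D') #<= D' ->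
  exists2 G, H `<` G & square_graph G.
Proof.
move=> [[HX Hinf] Hfield Htot Hf Hi] D'X D'H D'inf.
have [d D'd] := infinite_setN0 D'inf.
move=> /(card_le_injP d)[e eD' eI]; set D := field H in eD' eI *.
set E := D `|` D' in eD' eI *.
pose N : set ((T * T) * T) :=
  [set q | [/\ E q.1.1, E q.1.2, ~ (D q.1.1 /\ D q.1.2) & q.2 = e q.1]].
have D'DF x : D' x -> ~ D x by move=> D'x Dx; exact: (D'H x).
have fieldE : field (H `|` N) = E.
  apply/seteqP; split=> x.
    by move=> [z [Hz|[]//]]; left; exists z.
  move=> Ex; have [[z Hz]|nDx] := pselect (D x); first by exists z; left.
  by exists (e (x, x)); right; split=> // -[].
have ND' p z : N (p, z) -> D' z by move=> [/= ? ? _ ->]; exact: eD'.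
exists (H `|` N).
  split; first by move=> p; left.
  move=> sub; have Hd : H ((d, d), e (d, d)).
    by apply: sub; right; split=> /=; [right|right|case=> /D'DF|].
  by apply: (D'DF d) => //; exists (e (d, d)).
split; rewrite ?fieldE.
- split=> [x [/HX|/D'X]//|_].
  by apply: sub_infinite_set D'inf => x; right.
- move=> x y z [/Hfield[? ? ?]|Nz]; first by split; left.
  by split; [case: Nz|case: Nz|right; exact: ND' Nz].
- move=> x y Ex Ey; have [[Dx Dy]|nD] := pselect (D x /\ D y).
    by have [z Hz] := Htot _ _ Dx Dy; exists z; left.
  by exists (e (x, y)); right.
- move=> [x y] z z' [Hz|Nz] [Hz'|Nz'].
  + exact: Hf Hz Hz'.
  + by case: Nz' => _ _ []; have [] := Hfield _ _ _ Hz.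
  + by case: Nz => _ _ []; have [] := Hfield _ _ _ Hz'.
  + by case: Nz => /= _ _ _ ->; case: Nz'.
- move=> [x y] [x' y'] z [Hz|Nz] [Hz'|Nz'].
  + exact: Hi Hz Hz'.
  + by case: (D'DF z (ND' _ _ Nz')); have [] := Hfield _ _ _ Hz.
  + by case: (D'DF z (ND' _ _ Nz)); have [] := Hfield _ _ _ Hz'.
  + case: Nz Nz' => /= ? ? _ zE [/= ? ? _]; rewrite zE; exact: eI.
Qed.

(** Let [D] be the field of a maximal square graph. If [X] minus [D] injects into [D], then [X]
    itself does, and the square of [D] injects into [D]. Otherwise, by comparability, [X] minus [D]
    contains a copy of [D], along which the graph could be extended. *)
Lemma card_square : infinite_set X -> X `*` X #<= X.
Proof.
move=> Xinf; have [x0 Xx0] := infinite_setN0 Xinf.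
have [H [HP Hmax]] := Zorn_bigcup square_graph_chain.
have [[HX Hinf] Hfield Htot Hf Hi] := HP.
have [D0|/set0P Dn0] := eqVneq (field H) set0.
  have /(card_le_injP x0)[h hX hI] := (infiniteP X).1 Xinf.
  pose N := h @` setT.
  have natN : [set: nat] #<= N.
    apply/(card_le_injP x0); exists h => [n _|n m _ _ /hI]; last exact.
    by exists n.
  have Ninf : infinite_set N by apply/infiniteP.
  have NN : N `*` N #<= N.
    apply: card_le_trans natN.
    have Nnat : N #<= [set: nat] by exact: card_image_le.
    apply: (card_le_trans (card_leX Nnat Nnat)); rewrite setXTT.
    by rewrite (card_le_eql card_nat2).
  have [| | | |G HG GP] := square_graph_extend HP (D' := N).
  - by move=> _ [n _ <-]; exact: hX.
  - by rewrite D0 setI0.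
  - exact: Ninf.
  - by rewrite D0 set0U.
  - by case: (Hmax G).
have Dinf := Hinf Dn0; set D := field H in HX Hinf Dn0 Dinf Hfield Htot.
have DD : D `*` D #<= D.
  apply: (@card_le_graph _ _ _ _ (fun p z => H (p, z))).
    move=> [x y] [/= Dx Dy]; have [z Hz] := Htot _ _ Dx Dy.
    by exists z => //; have [] := Hfield _ _ _ Hz.
  by move=> p q z _ _; exact: Hi.
have /(card_le_injP x0)[h hD hI] := (infiniteP D).1 Dinf.
have h01 : h 0%N <> h 1%N by move=> /hI -/(_ I I).
have DU B : B #<= D -> D `|` B #<= D.
  by move=> BD; apply: (card_leU (hD 0%N I) (hD 1%N I)).
have [XD|DX] := card_le_total (X `\` D) D.
  have XleD : X #<= D.
    apply: card_le_trans (DU _ XD); apply: subset_card_le => x Xx.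
    by have [|] := pselect (D x); [left|right].
  apply: (card_le_trans (card_leX XleD XleD)); apply: (card_le_trans DD).
  exact: subset_card_le.
have /(card_le_injP x0)[g gX gI] := DX.
have gD : g @` D #<= D by exact: card_image_le.
have Dg : D #<= g @` D.
  by apply/(card_le_injP x0); exists g => // x Dx; exists x.
have [| | | |G HG GP] := square_graph_extend HP (D' := g @` D).
- by move=> _ [x /gX[+ _] <-].
- by move=> _ [[x Dx <-]]; have [_] := gX _ Dx.
- by apply: contra_not Dinf; exact: card_le_finite.
- apply: card_le_trans Dg; apply: card_le_trans DD.
  by apply: card_leX; exact: DU.
- by case: (Hmax G).
Qed.

End Square.

Lemma card_leX_infinite (T U V : Type) (A : set T) (B : set U) (M : set V) :
  infinite_set M -> A #<= M -> B #<= M -> A `*` B #<= M.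
Proof.
move=> Minf AM BM; exact: card_le_trans (card_leX AM BM) (card_square Minf).
Qed.

(** * Blocks of natural numbers and unbounded families *)

Definition infinitely_often (G : set nat) : Prop :=
  forall N, exists2 n, (N <= n)%N & G n.

Lemma not_infinitely_often (G : set nat) : ~ infinitely_often G ->
  exists N, forall n, (N <= n)%N -> ~ G n.
Proof.
move=> /existsNP[N NG]; exists N => n Nn Gn.
by apply: NG; exists n.
Qed.

(** The successor in each summand makes the cut points strictly increasing and puts the [k]-th one
    above [f k]. Numbers below [block_start f 0] belong to no block. *)
Definition block_start (f : nat -> nat) (k : nat) : nat :=
  (\sum_(0 <= m < k.+1) (f m).+1)%N.

Lemma block_startS f k :
  block_start f k.+1 = (block_start f k + (f k.+1).+1)%N.
Proof. by rewrite /block_start big_nat_recr. Qed.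

Lemma ltn_block_start f : {homo block_start f : m n / (m < n)%N}.
Proof.
apply: homo_ltn => [|k]; first exact: ltn_trans.
by rewrite block_startS addnS ltnS leq_addr.
Qed.

Lemma leq_block_start f : {homo block_start f : m n / (m <= n)%N}.
Proof. by apply: ltnW_homo; exact: ltn_block_start. Qed.

Lemma block_start_ge f k : (f k < block_start f k)%N.
Proof.
case: k => [|k]; first by rewrite /block_start big_nat1.
by rewrite block_startS leq_addl.
Qed.

Lemma block_start_ge_id f k : (k < block_start f k)%N.
Proof.
elim: k => [|k IH]; first by rewrite /block_start big_nat1.
exact: leq_ltn_trans IH (ltn_block_start _ (ltnSn k)).
Qed.

Lemma block_start_inj f x k l :
  (block_start f k <= x < block_start f k.+1)%N ->
  (block_start f l <= x < block_start f l.+1)%N -> k = l.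
Proof.
move=> /andP[kx xk] /andP[lx xl]; apply/eqP; rewrite eqn_leq; apply/andP; split.
  rewrite leqNgt; apply/negP => /(leq_block_start f) h.
  by have := leq_trans xl (leq_trans h kx); rewrite ltnn.
rewrite leqNgt; apply/negP => /(leq_block_start f) h.
by have := leq_trans xk (leq_trans h lx); rewrite ltnn.
Qed.

(* If block_start f k.+1 < g (block_start f k) eventually, then f is below  *)
(* the diagonal of the iterates of a monotone majorant of g.                  *)
Lemma unbounded_family_long_blocks (B : set (nat -> nat)) (g : nat -> nat) :
    unbounded_family B ->
  exists2 f, B f & infinitely_often
    [set k | (g (block_start f k) <= block_start f k.+1)%N].
Proof.
move=> Bunb; apply: contrapT => noB; apply: Bunb.
pose G := block_start g.
have iterG j : {homo iter j G : m n / (m <= n)%N}.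
  by elim: j => //= j IH m n mn; apply: leq_block_start; exact: IH.
have iterGS j m : (iter j G m <= iter j.+1 G m)%N.
  by rewrite iterS ltnW// block_start_ge_id.
have iterGl m : {homo (fun j => iter j G m) : j l / (j <= l)%N}.
  by apply: homo_leq => //; exact: leq_trans.
exists (fun k => iter k G k) => f Bf.
have [|N Nlt] := @not_infinitely_often
    [set k | (g (block_start f k) <= block_start f k.+1)%N].
  by move=> h; apply: noB; exists f.
(* From [N] on all blocks are short, so each cut point is at most [G] of the preceding one. *)
have leG j : (block_start f (N + j) <= iter j G (block_start f N))%N.
  elim: j => [|j IH]; first by rewrite addn0.
  rewrite addnS iterS.
  have /negP := Nlt (N + j)%N (leq_addr _ _); rewrite -ltnNge => /ltnW/leq_trans.
  apply; apply: leq_trans (ltnW (block_start_ge _ _)) _.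
  exact: leq_block_start.
(* Beyond this threshold [k] bounds the starting point of the iteration, so the diagonal value
   [iter k G k] bounds the [k]-th cut point and hence [f k]. *)
exists (block_start f N) => // k /= fNk.
have Nk : (N <= k)%N by rewrite (leq_trans _ fNk)// ltnW// block_start_ge_id.
apply: leq_trans (ltnW (block_start_ge f k)) _.
have := leG (k - N)%N; rewrite subnKC// => /leq_trans; apply.
apply: (leq_trans (iterG _ _ _ fNk)).
exact/iterGl/leq_subr.
Qed.

(** An enumeration of a finite, or just countable, family yields a bound: at [n], add the values of
    the members numbered up to [n]. The sum includes [f n] as soon as [n] reaches the number of
    [f]. *)
Lemma unbounded_family_infinite (B : set (nat -> nat)) :
  unbounded_family B -> infinite_set B.
Proof.
move=> Bunb Bfin.
have /(card_le_injP 0%N)[e _ eI] := finite_set_countable Bfin.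
apply: Bunb.
have /choice[h hP] i : exists h, forall f, B f -> e f = i -> h = f.
  have [[f [Bf fi]]|nf] := pselect (exists f, B f /\ e f = i).
    by exists f => f' Bf' f'i; apply: eI => //; rewrite fi.
  by exists id => f Bf fi; case: nf; exists f.
exists (fun n => \sum_(0 <= i < n.+1) h i n)%N => f Bf.
exists (e f) => // n /= efn.
rewrite big_mkord (bigD1 (Ordinal (efn : e f < n.+1)%N))//=.
by rewrite (hP _ f)// leq_addr.
Qed.

Lemma unbounded_familyT : unbounded_family setT.
Proof.
move=> [g /(_ (fun n => (g n).+1) I)[N _ /(_ N (leqnn N))]].
by rewrite /= ltnn.
Qed.

(** * Convergence of subseries *)

Section Subseries.
Variable R : realType.
Implicit Types (a : R^nat) (A B S : set nat).

Lemma is_cvg_norm_le (u : R^nat) : cvgn u -> exists M, forall n, `|u n| <= M.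
Proof.
move=> /cvg_seq_bounded ub.
have [M [_ uM]] : bounded_fun u := ub.
by exists (M + 1) => n; apply: (uM (M + 1)); rewrite ?ltrDl.
Qed.

Lemma subseriesE a A :
  subseries a A = series (fun k => if k \in A then a k else 0).
Proof. by apply/funext => n; rewrite /subseries big_mkcond. Qed.

Lemma subseries_setC a A n :
  subseries a A n + subseries a (~` A) n = series a n.
Proof.
rewrite /subseries /series/= [RHS](bigID (mem A))/=; congr (_ + _).
by apply: eq_bigl => k; rewrite in_setC.
Qed.

Lemma subseries_block a A B m n : (m <= n)%N ->
    (forall x, (m <= x < n)%N -> B x <-> A x) ->
  subseries a B n - subseries a B m = subseries a A n - subseries a A m.
Proof.
move=> mn AB; rewrite !subseriesE !sub_series_geq//.
rewrite [LHS]big_nat [RHS]big_nat; apply: eq_bigr => x /AB BA.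
suff -> : (x \in B) = (x \in A) by [].
by apply/idP/idP => /set_mem/BA/mem_set.
Qed.

Lemma normr_subseries a A n : `|subseries a A n| <= [normed series a] n.
Proof.
rewrite subseriesE /series/= (le_trans (ler_norm_sum _ _ _))//.
by apply: ler_sum => k _; case: ifP => // _; rewrite normr0.
Qed.

Lemma is_cvg_subseries_finite a A : ~ infinitely_often A ->
  cvgn (subseries a A).
Proof.
move=> /not_infinitely_often[N NA].
apply: (is_cvg_near_cst (subseries a A N)); exists N => // n /= Nn.
apply/eqP; rewrite -subr_eq0 (@subseries_block _ set0)//; last first.
  by move=> x /andP[Nx _]; split=> // /(NA _ Nx).
by rewrite /subseries !big_pred0 ?subrr// => k; rewrite in_set0.
Qed.

Lemma subseries_setCE a A :
  subseries a A = series a \- subseries a (~` A).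
Proof. by apply/funext => n /=; rewrite -(subseries_setC a A) addrK. Qed.

Lemma is_cvg_subseries_cofinite a A : cvgn (series a) ->
  ~ infinitely_often (~` A) -> cvgn (subseries a A).
Proof.
move=> ca fin.
by rewrite subseries_setCE; apply: is_cvgB => //; exact: is_cvg_subseries_finite.
Qed.

(** * Families with a divergent subseries, and splitting *)

(** The nonnegative terms form a divergent subseries: [|a k|] is twice the nonnegative part of [a k]
    minus [a k], so otherwise the series would converge absolutely. *)
Lemma ss_familyT : ss_family R setT.
Proof.
move=> a [ca nca]; exists [set k | 0 <= a k] => // cA; apply: nca.
rewrite (_ : [normed series a] =
    subseries a [set k | 0 <= a k] \+ subseries a [set k | 0 <= a k] \- series a).
  by apply: is_cvgB => //; exact: is_cvgD.
apply/funext => n /=; rewrite -(subseries_setC a [set k | 0 <= a k]).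
rewrite opprD addrA addrK !subseriesE /series/= -sumrB; apply: eq_bigr => k _.
rewrite in_setC; have [a0|a0] := leP 0 (a k).
  by rewrite mem_set//= subr0 ger0_norm.
by rewrite memNset/= ?sub0r ?ltr0_norm//; apply/negP; rewrite -ltNge.
Qed.

(* After j elements of G the partial sum is 0 if j is even and 1/(j+1) if j   *)
(* is odd.                                                                    *)
Lemma conditionally_convergent_support (G : set nat) : infinitely_often G ->
  exists2 a : R^nat, conditionally_convergent a & forall n, ~ G n -> a n = 0.
Proof.
move=> Ginf.
pose c n : nat := (\sum_(0 <= k < n) (k \in G))%N.
have cS n : c n.+1 = (c n + (n \in G))%N by rewrite /c big_nat_recr.
have c_le : {homo c : m n / (m <= n)%N}.
  apply: homo_leq => //; first exact: leq_trans.
  by move=> n; rewrite cS leq_addr.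
have c_unb M : exists N, (M <= c N)%N.
  elim: M => [|M [N MN]]; first by exists 0%N.
  have [n Nn Gn] := Ginf N; exists n.+1.
  by rewrite cS mem_set//= addn1 ltnS (leq_trans MN)// c_le.
pose s n : R := if odd (c n) then harmonic (c n) else 0.
exists (telescope s); last first.
  by move=> n nGn; rewrite /telescope/= /s cS memNset//= addn0 subrr.
split.
  rewrite telescopeK; apply: is_cvgB; last exact: is_cvg_cst.
  apply/cvg_ex; exists 0; apply: (@squeeze_cvgr _ _ _ _ (cst 0) (harmonic \o c)).
  - near=> n; rewrite /s /=; case: ifP => _; rewrite ?lexx ?invr_ge0 ?ler0n//=.
  - exact: cvg_cst.
  - apply: cvg_comp cvg_harmonic; apply/cvgnyPge => M.
    by have [N MN] := c_unb M; exists N => // n /= /c_le; exact: leq_trans.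
move=> /is_cvg_norm_le[M sM].
(* At an element of [G] the partial sum jumps between zero and a harmonic term, by at least
   [harmonic (c n).+1]; the summand 1 is [harmonic 0]. *)
have le_harm n : series harmonic (c n).+1 <= 1 + [normed series (telescope s)] n.
  elim: n => [|n IH].
    have -> : c 0%N = 0%N by rewrite /c big_geq.
    have -> : series harmonic 1%N = 1 :> R by rewrite /series/= big_nat1 invr1.
    by rewrite lerDl /series/= sumr_ge0.
  rewrite cS [X in _ + X]seriesSr addrA.
  case: (boolP (n \in G)) => /= nG; last by rewrite addn0 (le_trans IH)// lerDl.
  rewrite addn1 [leLHS]seriesSr; apply: lerD; first exact: IH.
  rewrite /telescope/= /s cS nG addn1/=; case: (odd (c n)) => /=.
    rewrite sub0r normrN ger0_norm ?invr_ge0 ?ler0n//.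
    by rewrite lef_pV2 ?posrE ?ltr0n// ler_nat.
  by rewrite subr0 ger0_norm ?invr_ge0 ?ler0n.
apply: (@dvg_harmonic R); apply: nondecreasing_is_cvgn.
  by apply/nondecreasing_series => n _ _; exact: harmonic_ge0.
exists (1 + M) => _ [n _ <-].
have [N nN] := c_unb n.
have := le_trans (le_harm N) (lerD (lexx 1) (le_trans (ler_norm _) (sM N))).
apply: le_trans; apply: nondecreasing_series => //.
  by move=> k _ _; exact: harmonic_ge0.
exact: leqW.
Unshelve. all: by end_near. Qed.

(** For a conditionally convergent series supported on [G], a set that meets [G] finitely often, or
    omits only finitely many of its elements, gives a convergent subseries. *)
Lemma ss_family_splits (F : set (set nat)) (G : set nat) :
    ss_family R F -> infinitely_often G ->
  exists2 S, F S & infinitely_often (G `&` S) /\ infinitely_often (G `\` S).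
Proof.
move=> Fss /conditionally_convergent_support[a ca aG].
have aE S : subseries a S = subseries a (G `&` S).
  apply/funext => n; rewrite !subseriesE; apply: eq_bigr => k _.
  rewrite in_setI; case: (boolP (k \in G)) => //= kG.
  by rewrite aG ?if_same//; move/negP: kG => + Gk; apply; exact/mem_set.
have [S FS dS] := Fss _ ca; exists S => //; split; apply: contrapT => fin.
  by apply: dS; rewrite aE; exact: is_cvg_subseries_finite.
apply: dS; rewrite subseries_setCE; apply: is_cvgB; first by case: ca.
by rewrite aE -setDE; exact: is_cvg_subseries_finite.
Qed.

(** * Oscillation by alternating blocks *)

Lemma oscillates_unbounded (u : R^nat) :
    (forall M, exists2 n, (M <= n)%N & M%:R <= u n) ->
    (forall M, exists2 n, (M <= n)%N & u n <= - M%:R) ->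
  oscillates u.
Proof.
move=> uge ule.
have big (x : R) : exists M : nat, x < M%:R.
  by exists (Num.bound `|x|); rewrite (le_lt_trans (ler_norm x))// archi_boundP.
split.
- move=> /is_cvg_norm_le[x ux]; have [M xM] := big x.
  have [n _ Mn] := uge M; have := le_trans (ler_norm _) (ux n).
  by rewrite leNgt (lt_le_trans xM Mn).
- move=> /cvgryPge/(_ 1)[N _ Nu]; have [n Nn] := ule N.
  have /= := Nu n Nn; rewrite leNgt => /negP u1 un; apply: u1.
  by rewrite (le_lt_trans un)// (@le_lt_trans _ _ 0)// oppr_le0 ler0n.
- move=> /cvgrNyPle/(_ (-1))[N _ Nu]; have [n Nn] := uge N.
  have /= := Nu n Nn; rewrite leNgt => /negP u1 un; apply: u1.
  by rewrite (lt_le_trans _ un)// (@lt_le_trans _ _ 0)// ltrN10.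
Qed.

(** At the start [n] of a block the partial sum over [B] lies within the absolute sum up to [n].
    Along a long block it moves as the sum over [P] or [Q] does, by at least that absolute sum plus
    [n], so it ends above [n] or below [-n], possibly with equality. *)
Lemma oscillates_blocks a P Q B S (g f : nat -> nat) :
    (forall n m, (g n <= m)%N ->
      subseries a P n + ([normed series a] n + n%:R) <= subseries a P m) ->
    (forall n m, (g n <= m)%N ->
      subseries a Q m <= subseries a Q n - ([normed series a] n + n%:R)) ->
    (forall k x, S k -> (block_start f k <= x < block_start f k.+1)%N ->
      B x <-> P x) ->
    (forall k x, ~ S k -> (block_start f k <= x < block_start f k.+1)%N ->
      B x <-> Q x) ->
    let G := [set k | (g (block_start f k) <= block_start f k.+1)%N] in
    infinitely_often (G `&` S) -> infinitely_often (G `\` S) ->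
  oscillates (subseries a B).
Proof.
move=> gP gQ BP BQ G GS GnS.
have startM M k : (M <= k)%N ->
    M%:R <= (block_start f k)%:R :> R /\ (M <= block_start f k.+1)%N.
  move=> Mk; have /ltnW kp := block_start_ge_id f k.
  rewrite ler_nat (leq_trans Mk kp); split=> //.
  by rewrite (leq_trans (leq_trans Mk kp))// leq_block_start.
have lower n : - [normed series a] n <= subseries a B n.
  by rewrite lerNl (le_trans _ (normr_subseries a B n))// -normrN ler_norm.
have upper n : subseries a B n <= [normed series a] n.
  exact: le_trans (ler_norm _) (normr_subseries _ _ _).
apply: oscillates_unbounded => M.
  have [k Mk [Gk Sk]] := GS M; have [Mp Mp1] := startM _ _ Mk.
  exists (block_start f k.+1) => //; apply: (le_trans Mp).
  have /eqP := subseries_block a (leq_block_start f (leqnSn k)) (fun x => BP k x Sk).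
  rewrite subr_eq => /eqP ->.
  have := gP _ _ Gk; have := lower (block_start f k).
  move: (subseries a B _) (subseries a P _) (subseries a P _) => b p q.
  by move: ([normed series a] _) (_%:R) => x y; lra.
have [k Mk [Gk Sk]] := GnS M; have [Mp Mp1] := startM _ _ Mk.
exists (block_start f k.+1) => //; move: Mp; rewrite -lerN2; apply: le_trans.
have /eqP := subseries_block a (leq_block_start f (leqnSn k)) (fun x => BQ k x Sk).
rewrite subr_eq => /eqP ->.
have := gQ _ _ Gk; have := upper (block_start f k).
move: (subseries a B _) (subseries a Q _) (subseries a Q _) => b p q.
by move: ([normed series a] _) (_%:R) => x y; lra.
Qed.

Lemma cvgryPge_modulus (u b : R^nat) : u @ \oo --> +oo ->
  exists g : nat -> nat, forall n m, (g n <= m)%N -> b n <= u m.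
Proof.
move=> /cvgryPge u_oo.
have /choice[g gP] n : exists N, forall m, (N <= m)%N -> b n <= u m.
  by have [N _ Nu] := u_oo (b n); exists N => m /Nu.
by exists g.
Qed.

Lemma subseries_setC_cvgNy a A : cvgn (series a) ->
  subseries a A @ \oo --> +oo -> subseries a (~` A) @ \oo --> -oo.
Proof.
move=> /is_cvg_norm_le[M aM] /cvgryPge Aoo; apply/cvgrNyPle => x.
have [N _ NA] := Aoo (M - x); exists N => // n /NA /=.
have := le_trans (ler_norm _) (aM n); rewrite -(subseries_setC a A n).
by move: (subseries a A n) (subseries a _ n) => p q; lra.
Qed.

Lemma subseries_setC_cvgy a A : cvgn (series a) ->
  subseries a A @ \oo --> -oo -> subseries a (~` A) @ \oo --> +oo.
Proof.
move=> /is_cvg_norm_le[M aM] /cvgrNyPle Aoo; apply/cvgryPge => x.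
have [N _ NA] := Aoo (- M - x); exists N => // n /NA /=.
have := aM n; rewrite ler_norml => /andP[+ _].
rewrite -(subseries_setC a A n).
by move: (subseries a A n) (subseries a _ n) => p q; lra.
Qed.

Lemma blocks_modulus a P Q :
    subseries a P @ \oo --> +oo -> subseries a Q @ \oo --> -oo ->
  exists g : nat -> nat,
    (forall n m, (g n <= m)%N ->
      subseries a P n + ([normed series a] n + n%:R) <= subseries a P m) /\
    (forall n m, (g n <= m)%N ->
      subseries a Q m <= subseries a Q n - ([normed series a] n + n%:R)).
Proof.
move=> Poo /cvgNry Qoo; have [g1 g1P] := cvgryPge_modulus
  (fun n => subseries a P n + ([normed series a] n + n%:R)) Poo.
have [g2 g2P] := cvgryPge_modulus
  (fun n => - (subseries a Q n - ([normed series a] n + n%:R))) Qoo.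
exists (fun n => maxn (g1 n) (g2 n)); split=> n m; rewrite geq_max => /andP[g1m g2m].
  exact: g1P.
by rewrite -lerN2; exact: g2P.
Qed.

(** The equivalence [S k <-> A x] selects [A] on blocks with index in [S] and the complement of [A]
    on the others. *)
Definition alternation (A S : set nat) (f : nat -> nat) : set nat :=
  [set x | exists2 k, (block_start f k <= x < block_start f k.+1)%N &
                      (S k <-> A x)].

Lemma alternation_in A S f k x :
    (block_start f k <= x < block_start f k.+1)%N -> S k ->
  alternation A S f x <-> A x.
Proof.
move=> xk Sk; split; last by exists k.
by move=> [l xl SA]; apply/SA; rewrite -(block_start_inj xk xl).
Qed.

Lemma alternation_notin A S f k x :
    (block_start f k <= x < block_start f k.+1)%N -> ~ S k ->
  alternation A S f x <-> (~` A) x.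
Proof.
move=> xk nSk; split; last by move=> nAx; exists k.
by move=> [l xl SA] /SA; rewrite -(block_start_inj xk xl).
Qed.

Lemma oscillates_alternation (F : set (set nat)) (B : set (nat -> nat)) a A :
    ss_family R F -> unbounded_family B -> cvgn (series a) ->
    subseries a A @ \oo --> +oo \/ subseries a A @ \oo --> -oo ->
  exists2 S, F S & exists2 f, B f & oscillates (subseries a (alternation A S f)).
Proof.
move=> Fss Bunb ca [Aoo|Aoo].
  have [g [gP gQ]] := blocks_modulus Aoo (subseries_setC_cvgNy ca Aoo).
  have [f Bf Ginf] := unbounded_family_long_blocks g Bunb.
  have [S FS [GS GnS]] := ss_family_splits Fss Ginf.
  exists S => //; exists f => //; apply: (oscillates_blocks gP gQ _ _ GS GnS).
    by move=> k x Sk xk; exact: alternation_in xk Sk.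
  by move=> k x Sk xk; exact: alternation_notin xk Sk.
have [g [gP gQ]] := blocks_modulus (subseries_setC_cvgy ca Aoo) Aoo.
have [f Bf Ginf] := unbounded_family_long_blocks g Bunb.
have [S FS [GS GnS]] := ss_family_splits Fss Ginf.
exists S => //; exists f => //.
(* Here the complement of [A] drives the sum upwards, so the upward blocks are those outside [S]. *)
apply: (oscillates_blocks (S := ~` S) gP gQ _ _ GnS).
- by move=> k x Sk xk; exact: alternation_notin xk Sk.
- by move=> k x /contrapT Sk xk; exact: alternation_in xk Sk.
- by rewrite setDE setCK.
Qed.

(** * The oscillating family and its cardinality *)

(** The Boolean flag retains the members of [F] themselves, for series on which they already
    oscillate. *)
Definition alternations (F : set (set nat)) (B : set (nat -> nat)) :
    set (set nat) :=
  (fun q => if q.2 then q.1.1.1 else alternation q.1.1.1 q.1.1.2 q.1.2)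
    @` (F `*` F `*` B `*` [set: bool]).

Lemma sso_family_alternations (F : set (set nat)) (B : set (nat -> nat)) :
  ss_family R F -> unbounded_family B -> sso_family R (alternations F B).
Proof.
move=> Fss Bunb a cca; have [A FA dA] := Fss _ cca.
have [Aosc|Anosc] := pselect (oscillates (subseries a A)).
  exists A => //; have [f Bf] := infinite_setN0 (unbounded_family_infinite Bunb).
  by exists (A, A, f, true).
have Aoo : subseries a A @ \oo --> +oo \/ subseries a A @ \oo --> -oo.
  by apply: contrapT => /not_orP[ny nNy]; apply: Anosc.
have [S FS [f Bf osc]] := oscillates_alternation Fss Bunb cca.1 Aoo.
by exists (alternation A S f) => //; exists (A, S, f, false).
Qed.

Lemma card_alternations (T : Type) (F : set (set nat)) (B : set (nat -> nat))
    (M : set T) :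
  infinite_set M -> F #<= M -> B #<= M -> alternations F B #<= M.
Proof.
move=> Minf FM BM; apply: (card_le_trans (card_image_le _ _)).
do !apply: card_leX_infinite => //.
exact: card_le_trans (countableP _) ((infiniteP _).1 Minf).
Qed.

End Subseries.

Lemma card_le_max (T U : Type) (A : set T) (B : set U) :
  A #<= card_max A B /\ B #<= card_max A B.
Proof.
have inrB : B #<= @inr T U @` B.
  apply: (@card_le_graph _ _ _ _ (fun x y => y = inr x)) => [x Bx|].
    by exists (inr x) => //; exists x.
  by move=> x x' _ _ _ -> [].
have inlA : A #<= @inl T U @` A.
  apply: (@card_le_graph _ _ _ _ (fun x y => y = inl x)) => [x Ax|].
    by exists (inl x) => //; exists x.
  by move=> x x' _ _ _ -> [].
rewrite /card_max; case: ifPn => [AB|/negP nAB].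
  by split=> //; exact: card_le_trans AB inrB.
by split=> //; have [//|BA] := card_le_total A B; exact: card_le_trans BA inlA.
Qed.

Theorem theorem21 (R : realType) :
  osc_subseries_number R #<= card_max (subseries_number R) bounding_number.
Proof.
(* The family of all sets and that of all functions qualify, so both minima are attained. *)
have [Fss _] := least_setP (ex_intro _ _ (@ss_familyT R)).
have [Bunb _] := least_setP (ex_intro _ _ unbounded_familyT).
rewrite -/(subseries_number R) in Fss; rewrite -/bounding_number in Bunb.
have Hsso := sso_family_alternations Fss Bunb.
have [_ /(_ _ Hsso) osc_le] := least_setP (ex_intro _ _ Hsso).
apply: (card_le_trans osc_le).
have [FM BM] := card_le_max (subseries_number R) bounding_number.
apply: card_alternations => //.
by apply: contra_not (unbounded_family_infinite Bunb); exact: card_le_finite.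
Qed.
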